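(* Almost every set is not almost everywhere dominating; that is, for almost all $A\in 2^\omega$, $A$ is not almost everywhere dominating.
   Context: $\mu$ is the fair-coin (Lebesgue) probability measure on $2^\omega$; ''almost all'' means on a set of $\mu$-measure $1$. For $f,g\in\omega^\omega$, $f$ dominates $g$ if $\exists m\,\forall n>m\,(f(n)>g(n))$. A set $A$ is almost everywhere (a.e.) dominating if for almost all $X\in 2^\omega$ and all functions $g\leq_T X$, there is a function $f\leq_T A$ such that $f$ dominates $g$. *)

(* Defs.v *)
From HB Require Import structures.
From mathcomp Require Import all_boot all_order all_algebra.
From mathcomp Require Import zify.
From mathcomp Require Import all_classical all_reals all_analysis.
From mathcomp Require Import measurable_realfun.

Set Implicit Arguments.
Unset Strict Implicit.
Unset Printing Implicit Defensive.

Import Order.TTheory GRing.Theory Num.Theory.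
Import numFieldNormedType.Exports.

Local Open Scope classical_set_scope.

(* Kleene's schemes for the partial functions recursive in an oracle.  The     *)
(* index is the arity; 0-ary codes are needed for [PrimRec] on one argument.   *)
Inductive recursive_code : nat -> Type :=
| Zero n : recursive_code n
| Succ : recursive_code 1
| Oracle : recursive_code 1
| Proj n (i : 'I_n) : recursive_code n
| Comp m n (f : recursive_code m) (g : 'I_m -> recursive_code n) :
    recursive_code n
| PrimRec n (f : recursive_code n) (g : recursive_code n.+2) :
    recursive_code n.+1
| Mu n (f : recursive_code n.+1) : recursive_code n.

(* [eval X c v y]: the computation of c with oracle X on input v halts with    *)
(* output y.  The recursion variable of [PrimRec] and the search variable of   *)
(* [Mu] come first; [Mu f] requires f to be defined and nonzero below y.       *)
Fixpoint eval (X : nat -> bool) n (c : recursive_code n) :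
    n.-tuple nat -> nat -> Prop :=
  match c in recursive_code n return n.-tuple nat -> nat -> Prop with
  | Zero _ => fun _ y => y = 0
  | Succ => fun v y => y = (thead v).+1
  | Oracle => fun v y => y = X (thead v)
  | Proj _ i => fun v y => y = tnth v i
  | @Comp m _ f g => fun v y => exists w : m.-tuple nat,
      (forall i, eval X (g i) v (tnth w i)) /\ eval X f w y
  | @PrimRec n f g => fun v =>
      (fix rec k (y : nat) : Prop :=
        match k with
        | 0 => eval X f [tuple of behead v] y
        | k.+1 => exists z, rec k z /\
                    eval X g [tuple of k :: z :: behead v] y
        end) (thead v)
  | Mu _ f => fun v y => eval X f [tuple of y :: v] 0 /\
      (forall z, z < y -> exists k, eval X f [tuple of z :: v] k.+1)
  end.

Lemma eval_functional X n (c : recursive_code n) v y y' :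
  eval X c v y -> eval X c v y' -> y = y'.
Proof.
elim: c v y y' => /= {n}.
- by move=> n v y y' -> ->.
- by move=> v y y' -> ->.
- by move=> v y y' -> ->.
- by move=> n i v y y' -> ->.
- move=> m n f IHf g IHg v y y' [w [gw fw]] [w' [gw' fw']].
  suff ww' : w = w' by subst w'; exact: IHf fw fw'.
  by apply: eq_from_tnth => i; exact: IHg (gw i) (gw' i).
- move=> n f IHf g IHg v; elim: (thead v) => [|k IHk] y y'; first exact: IHf.
  move=> [z [hz gz]] [z' [hz' gz']].
  by move: gz'; rewrite -(IHk _ _ hz hz'); exact: IHg gz.
- move=> n f IHf v y y' [fy Hy] [fy' Hy'].
  have [lt|lt|//] := ltngtP y y'.
  + by have [k fk] := Hy' _ lt; have := IHf _ _ _ fy fk.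
  + by have [k fk] := Hy _ lt; have := IHf _ _ _ fy' fk.
Qed.

(* g <=_T X, where the set X is identified with its characteristic function.   *)
Definition turing_reducible (g : nat -> nat) (X : nat -> bool) : Prop :=
  exists c : recursive_code 1, forall n, eval X c [tuple n] (g n).

Definition dominates (f g : nat -> nat) : Prop :=
  exists m, forall n, m < n -> g n < f n.

(* The fair-coin measure on the product sigma-algebra of 2^omega, constructed  *)
(* as the law of the sequence of binary digits of a uniform point of [0, 1].   *)
Definition coordinate_events : set (set (nat -> bool)) :=
  [set E | exists n, E = [set X : nat -> bool | X n]].

Definition coin_space := g_sigma_algebraType coordinate_events.

Section fair_coin.
Variable R : realType.
Local Open Scope ring_scope.

Definition binary_digits (x : measurableTypeR R) : coin_space :=
  fun n => odd (Num.truncn (2 ^+ n.+1 * x : R)).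

Lemma measurable_odd_truncn :
  measurable [set y : measurableTypeR R | odd (Num.truncn (y : R))].
Proof.
rewrite (_ : mkset _ = \bigcup_(m in [set m | odd m]) `[m%:R, m.+1%:R[%classic).
  by apply: bigcup_measurable => m _; exact: measurable_itv.
apply/seteqP; split=> [y /= oy|y [m /= om]].
  exists (Num.truncn (y : R)) => //=; rewrite in_itv/=; apply: truncn_itv.
  have := truncn_gt0 (y : R); case: (Num.truncn _) oy => //= m _ /esym.
  exact: le_trans.
by rewrite in_itv/= => /truncn_def ->.
Qed.

Lemma measurable_binary_digits : measurable_fun setT binary_digits.
Proof.
apply: (@measurability _ _ _ coin_space setT binary_digits coordinate_events) =>
  // _ [_ [n ->] <-]; rewrite setTI.
have mf : measurable_fun setT
    (fun x : measurableTypeR R => 2 ^+ n.+1 * x : measurableTypeR R).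
  exact: mulrl_measurable.
by rewrite -[X in measurable X]setTI; exact: mf measurable_odd_truncn.
Qed.

HB.instance Definition _ :=
  isMeasurableFun.Build _ _ _ _ binary_digits measurable_binary_digits.

Definition fair_coin : probability coin_space R :=
  distribution (uniform_prob (@ltr01 R)) binary_digits.

Definition cylinder (s : seq bool) : set coin_space :=
  [set X | forall i, (i < size s)%N -> X i = nth false s i].

Lemma measurable_cylinder (s : seq bool) : measurable (cylinder s).
Proof.
rewrite (_ : cylinder s = \bigcap_i
    [set X : coin_space | (i < size s)%N -> X i = nth false s i]); last first.
  by apply/seteqP; split=> X /= XP i; [move=> _|]; exact: XP.
apply: bigcap_measurable => // i _.
case: ltnP => [_|_]; last first.
  by rewrite (_ : mkset _ = setT)//; apply/seteqP; split.
have mi : measurable ([set X | X i] : set coin_space).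
  by apply: sub_sigma_algebra; exists i.
case: (nth false s i).
  rewrite (_ : mkset _ = [set X : coin_space | X i])//.
  by apply/seteqP; split=> X /=; [exact|move=> Xi _].
rewrite (_ : mkset _ = ~` [set X : coin_space | X i]); first exact: measurableC.
by apply/seteqP; split=> X /=; [move=> ->//|move=> /negP/negbTE].
Qed.

Lemma half_truncn_double (x : R) : 0 <= x ->
  (Num.truncn (2 * x))./2 = Num.truncn x.
Proof.
move=> x0; have x20 : 0 <= 2 * x by rewrite mulr_ge0.
apply/esym/truncn_def; have /andP[h1 h2] := truncn_itv x20.
set m := Num.truncn _ in h1 h2 *; apply/andP; split.
  rewrite -(ler_pM2l (ltr0n R 2)) (le_trans _ h1)// -natrM ler_nat mul2n.
  by rewrite -[leqRHS]odd_double_half leq_addl.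
rewrite -(ltr_pM2l (ltr0n R 2)) (lt_le_trans h2)// -natrM ler_nat mul2n.
by rewrite -[m in leqLHS]odd_double_half doubleS -addn2 -addn1; case: odd; lia.
Qed.

Lemma cylinder_digits (s : seq bool) : exists2 k, (k < 2 ^ size s)%N &
  forall x : R, 0 <= x < 1 ->
    cylinder s (binary_digits x) <-> Num.truncn (2 ^+ size s * x) = k.
Proof.
elim/last_ind: s => [|s b [k k2 IH]].
  exists 0%N => // x x01; split => [_|_ i]//.
  by apply: truncn_def; rewrite expr0 mul1r.
exists (b + k.*2)%N.
  rewrite size_rcons expnS mul2n; case: b => /=; lia.
move=> x x01; have x0 : 0 <= 2 ^+ size s * x.
  by case/andP: x01 => x0 _; rewrite mulr_ge0// exprn_ge0.
have h := half_truncn_double x0.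
rewrite mulrA -exprS in h; rewrite size_rcons.
have step : cylinder (rcons s b) (binary_digits x) <->
    cylinder s (binary_digits x) /\ binary_digits x (size s) = b.
  rewrite /cylinder/=; split=> [H|[H Hb] i].
    split=> [i si|]; last first.
      by rewrite H ?size_rcons// nth_rcons ltnn eqxx.
    by rewrite H ?size_rcons ?ltnS 1?ltnW// nth_rcons si.
  rewrite size_rcons ltnS leq_eqVlt nth_rcons => /orP[/eqP ->|si].
    by rewrite ltnn eqxx.
  by rewrite si; exact: H.
apply: (iff_trans step); rewrite /binary_digits; split=> [[/(IH _ x01) Hk Hb]|E].
  by rewrite -[LHS]odd_double_half h Hk Hb.
split; last by rewrite E oddD odd_double addbF oddb.
by apply/(IH _ x01); rewrite -h E half_bit_double.
Qed.

Lemma uniform_probE (A : set (measurableTypeR R)) : measurable A ->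
  uniform_prob (@ltr01 R) A = lebesgue_measure (A `&` `[0, 1]).
Proof.
move=> mA; rewrite /uniform_prob integral_uniform_pdf.
rewrite (eq_integral (cst 1%:E)).
  by rewrite integral_cst ?mul1e//; exact: measurableI.
move=> x; rewrite inE => -[_]; rewrite /= in_itv/= /uniform_pdf => ->.
by rewrite subr0 invr1.
Qed.

Lemma fair_coin_cylinder (s : seq bool) :
  fair_coin (cylinder s) = ((2^-1) ^+ size s)%:E.
Proof.
have mP : measurable (binary_digits @^-1` cylinder s).
  rewrite -[X in measurable X]setTI.
  by apply: measurable_binary_digits => //; exact: measurable_cylinder.
transitivity (uniform_prob (@ltr01 R) (binary_digits @^-1` cylinder s)) => //.
rewrite uniform_probE//; have [k k2 kP] := cylinder_digits s.
set P := _ @^-1` _ in mP *; set n := size s in k2 kP *.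
have n0 : 0 < 2 ^+ n :> R by rewrite exprn_gt0.
have -> : P `&` `[0, 1] =
    `[k%:R / 2 ^+ n, k.+1%:R / 2 ^+ n[ `|` (P `&` [set 1 : R]).
  have sub (x : R) : x \in `[k%:R / 2 ^+ n, k.+1%:R / 2 ^+ n[ -> 0 <= x < 1.
    rewrite in_itv/= => /andP[kx xk]; rewrite (le_trans _ kx) ?divr_ge0 ?ler0n ?ltW//=.
    by rewrite (lt_le_trans xk)// ler_pdivrMr// mul1r -natrX ler_nat.
  have PE (x : R) : 0 <= x < 1 -> P x <-> x \in `[k%:R / 2 ^+ n, k.+1%:R / 2 ^+ n[.
    move=> x01; apply: (iff_trans (kP x x01)).
    rewrite in_itv/= ler_pdivrMr// ltr_pdivlMr// mulrC.
    have x0 : 0 <= x * 2 ^+ n by case/andP: x01 => x0 _; rewrite mulr_ge0// ltW.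
    by rewrite -truncn_eq//; split=> /eqP.
  apply/seteqP; split=> x /=.
    move=> [Px]; rewrite in_itv/= => /andP[x0].
    rewrite le_eqVlt => /orP[/eqP x1|x1]; first by right.
    by left; apply/PE; rewrite ?x0.
  move=> [xI|[Px x1]]; last by split=> //; rewrite x1 in_itv/= ler01 lexx.
  have x01 := sub _ xI; split; first exact/PE.
  by rewrite in_itv/=; case/andP: x01 => -> /ltW.
rewrite measureU0//.
- rewrite [LHS]lebesgue_measure_itv/= lte_fin ltr_pM2r ?invr_gt0// ltr_nat ltnSn.
  by rewrite -EFinD -mulrBl -natrB// subSnn mul1r exprVn.
- exact: measurableI.
- apply/eqP; rewrite -measure_le0.
  rewrite -(lebesgue_measure_set1 (1 : R)); apply: le_measure => //.
  + by rewrite inE; exact: measurableI.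
  + by rewrite inE.
Qed.

End fair_coin.

Definition ae_dominating (R : realType) (A : nat -> bool) : Prop :=
  \forall X \ae fair_coin R, forall g, turing_reducible g X ->
    exists f, turing_reducible f A /\ dominates f g.

(* Main.v *)
Require Import Defs.
From mathcomp Require Import all_boot all_order all_algebra.
From mathcomp Require Import zify lra.
From mathcomp Require Import all_classical all_reals all_analysis.

(* Let [g] be dominated, for a non-null set [B] of oracles [A], by the function that one
   program computes from [A].  Let [D] be the set of oracles making that program total, and
   pick a rational [q] with [mu D - mu B < q < mu D].  The search for a stage [s] by which
   the program halts on all inputs up to [n], with outputs at most [s], for a set of oracles
   of measure at least [q] succeeds for every [n].  For large [n] the set found meets [B],
   so that [g n < s].

   On the other hand one functional escapes all these searches [E] at once, on a set of [X]
   of measure at least 1/2, by risking measure as in Kurtz's theorem that almost every set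
   has hyperimmune degree.  Attack number [w] against [E] is carried out, at some argument
   [n], by those [X] whose first [E + 2] bits code [w]: they wait for the search [E] at [n]
   and output at least its result.  The next attack starts only once that search is seen to
   succeed, so at most one cylinder of measure [2 ^ - (E + 2)] is lost to waiting forever.

   So for non-null many [X] the set of [A] that dominate the functional at [X] is null, and
   Fubini's theorem exchanges the roles of [A] and [X]. *)

Set Implicit Arguments.
Unset Strict Implicit.
Unset Printing Implicit Defensive.

Import Order.TTheory GRing.Theory Num.Theory.

Local Open Scope classical_set_scope.

(** * Recursive functions and pairing *)

Definition recursive n (F : (nat -> bool) -> n.-tuple nat -> nat) :=
  exists c : recursive_code n, forall X v, Defs.eval X c v (F X v).

Lemma recursive_ext n (F G : (nat -> bool) -> n.-tuple nat -> nat) :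
  (forall X v, F X v = G X v) -> recursive F -> recursive G.
Proof. by move=> FG [c Hc]; exists c => X v; rewrite -FG. Qed.

Lemma recursive_proj n (i : 'I_n) : recursive (fun _ v => tnth v i).
Proof. by exists (Proj i). Qed.

Lemma recursive_comp m n (F : (nat -> bool) -> m.-tuple nat -> nat)
    (G : 'I_m -> (nat -> bool) -> n.-tuple nat -> nat) :
  recursive F -> (forall i, recursive (G i)) ->
  recursive (fun X v => F X [tuple G i X v | i < m]).
Proof.
move=> [f Hf] /boolp.choice[g Hg]; exists (Comp f g) => X v /=.
by exists [tuple G i X v | i < m]; split=> // i; rewrite tnth_mktuple.
Qed.

Lemma recursive_primrec n (F : (nat -> bool) -> n.-tuple nat -> nat)
    (G : (nat -> bool) -> n.+2.-tuple nat -> nat) :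
  recursive F -> recursive G ->
  recursive (fun X (v : n.+1.-tuple nat) => nat_rec (fun _ => nat)
    (F X [tuple of behead v])
    (fun k z => G X [tuple of k :: z :: behead v]) (thead v)).
Proof.
move=> [f Hf] [g Hg]; exists (PrimRec f g) => X v /=.
by elim: (thead v) => [|k IHk] /=; [exact: Hf|eexists; split; [exact: IHk|exact: Hg]].
Qed.

Lemma recursive_comp1 n (f : nat -> nat) F :
  recursive (fun _ (v : 1.-tuple nat) => f (thead v)) ->
  @recursive n F -> recursive (fun X v => f (F X v)).
Proof.
move=> rf rF; apply: recursive_ext (recursive_comp rf (fun=> rF)) => X v.
by rewrite /thead tnth_mktuple.
Qed.

Lemma recursive_comp2 n (f : nat -> nat -> nat) F G :
  recursive (fun _ (v : 2.-tuple nat) => f (thead v) (tnth v ord_max)) ->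
  @recursive n F -> recursive G -> recursive (fun X v => f (F X v) (G X v)).
Proof.
move=> rf rF rG.
apply: recursive_ext (recursive_comp (G := fun i => if i == ord0 then F else G) rf _) => [X v|i].
  by rewrite /thead !tnth_mktuple.
by case: ifP.
Qed.

Lemma recursive_succ n F : @recursive n F -> recursive (fun X v => (F X v).+1).
Proof. by apply: recursive_comp1; exists Succ. Qed.

Lemma recursive_cst n k : @recursive n (fun _ _ => k).
Proof. by elim: k => [|k IH]; [exists (Zero n)|exact: recursive_succ IH]. Qed.

Lemma recursive_oracle n F : @recursive n F -> recursive (fun X v => X (F X v) : nat).
Proof.
move=> rF; have rO : recursive (fun X (v : 1.-tuple nat) => X (thead v) : nat).
  by exists Oracle.
apply: recursive_ext (recursive_comp rO (fun=> rF)) => X v.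
by rewrite /thead tnth_mktuple.
Qed.

Lemma recursive_add n F G :
  @recursive n F -> recursive G -> recursive (fun X v => F X v + G X v).
Proof.
apply: recursive_comp2.
apply: recursive_ext (recursive_primrec (recursive_proj ord0)
  (recursive_succ (recursive_proj (inord 1)))) => X v.
rewrite (_ : tnth _ ord0 = tnth v ord_max); last by case/tupleP: v => a v; case/tupleP: v.
elim: (thead v) => //= k ->; rewrite /tnth inordK//.
Qed.

Lemma recursive_pred n F : @recursive n F -> recursive (fun X v => (F X v).-1).
Proof.
apply: recursive_comp1.
apply: recursive_ext (recursive_primrec (recursive_cst 0 0) (recursive_proj ord0)) => X v.
by case: (thead v).
Qed.

Lemma recursive_sub n F G :
  @recursive n F -> recursive G -> recursive (fun X v => F X v - G X v).
Proof.
move=> rF rG; move: rG rF.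
(* [PrimRec] recurses on the first argument and truncated subtraction on the subtrahend, so the
   arguments are swapped. *)
apply: (@recursive_comp2 _ (fun a b => b - a)).
apply: recursive_ext (recursive_primrec (recursive_proj ord0)
  (recursive_pred (recursive_proj (inord 1)))) => X v.
rewrite (_ : tnth _ ord0 = tnth v ord_max); last by case/tupleP: v => a v; case/tupleP: v.
elim: (thead v) => [|k /= ->]; first by rewrite subn0.
by rewrite /tnth inordK//= -subnS.
Qed.

Lemma recursive_mul n F G :
  @recursive n F -> recursive G -> recursive (fun X v => F X v * G X v).
Proof.
apply: recursive_comp2.
apply: recursive_ext (recursive_primrec (recursive_cst 1 0)
  (recursive_add (recursive_proj (inord 2)) (recursive_proj (inord 1)))) => X v.
elim: (thead v) => //= k ->; rewrite mulSn; congr (_ + _); rewrite /tnth inordK//.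
by case/tupleP: v => a v; case/tupleP: v.
Qed.

(** The increment is [1] exactly when the next square does not exceed [n]; truncated subtraction
    replaces the case distinction. *)
Fixpoint isqrt n := if n is n'.+1 then
  isqrt n' + (1 - ((isqrt n').+1 * (isqrt n').+1 - n)) else 0.

Lemma isqrtP n : isqrt n * isqrt n <= n < (isqrt n).+1 * (isqrt n).+1.
Proof.
elim: n => //= n IH; set r := isqrt n in IH *.
case E : (r.+1 * r.+1 - n.+1) => [|k] /=; rewrite ?(addn0, subn0, sub0n, addn1) ?subSS; nia.
Qed.

Lemma recursive_isqrt n F : @recursive n F -> recursive (fun X v => isqrt (F X v)).
Proof.
apply: recursive_comp1.
pose r := recursive_proj (inord 1 : 'I_2); have r' := recursive_succ r.
apply: recursive_ext (recursive_primrec (recursive_cst 0 0)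
  (recursive_add r (recursive_sub (recursive_cst _ 1)
    (recursive_sub (recursive_mul r' r') (recursive_succ (recursive_proj ord0)))))) => X v.
elim: (thead v) => //= k ->; rewrite /tnth inordK//.
Qed.

(** The code lies before the square of [a + b + 1], so the integer square root recovers [a + b]. The
    pairing is injective, not surjective, and sends [0, 0] to [0]. *)
Definition npair a b := (a + b) * (a + b) + a.
Definition nfst n := n - isqrt n * isqrt n.
Definition nsnd n := isqrt n - nfst n.

Lemma isqrt_npair a b : isqrt (npair a b) = a + b.
Proof. by have := isqrtP (npair a b); rewrite /npair; set r := isqrt _; nia. Qed.

Lemma nfst_npair a b : nfst (npair a b) = a.
Proof. by rewrite /nfst isqrt_npair /npair addKn. Qed.

Lemma nsnd_npair a b : nsnd (npair a b) = b.
Proof. by rewrite /nsnd nfst_npair isqrt_npair addKn. Qed.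

Lemma leq_npairr a b : b <= npair a b. Proof. rewrite /npair; nia. Qed.

(** * Closure properties of computable unary functionals *)

Definition computable (F : (nat -> bool) -> nat -> nat) :=
  recursive (fun X (v : 1.-tuple nat) => F X (thead v)).

Lemma computable_ext F G :
  (forall X n, F X n = G X n) -> computable F -> computable G.
Proof. by move=> FG; apply: recursive_ext => X v; exact: FG. Qed.

Lemma computable_id : computable (fun _ n => n).
Proof. exact: recursive_proj. Qed.

Lemma computable_cst k : computable (fun _ _ => k).
Proof. exact: recursive_cst. Qed.

Lemma computable_comp F G :
  computable F -> computable G -> computable (fun X n => F X (G X n)).
Proof.
move=> cF cG; apply: recursive_ext (recursive_comp cF (fun=> cG)) => X v.
by rewrite /thead tnth_mktuple.
Qed.

Section closure.
Variables F G : (nat -> bool) -> nat -> nat.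
Hypotheses (cF : computable F) (cG : computable G).

Lemma computable_succ : computable (fun X n => (F X n).+1).
Proof. exact: recursive_succ cF. Qed.

Lemma computable_oracle : computable (fun X n => nat_of_bool (X (F X n))).
Proof. exact: recursive_oracle cF. Qed.

Lemma computable_add : computable (fun X n => F X n + G X n).
Proof. exact: recursive_add cF cG. Qed.

Lemma computable_sub : computable (fun X n => F X n - G X n).
Proof. exact: recursive_sub cF cG. Qed.

Lemma computable_mul : computable (fun X n => F X n * G X n).
Proof. exact: recursive_mul cF cG. Qed.

Lemma computable_pred : computable (fun X n => (F X n).-1).
Proof. exact: recursive_pred cF. Qed.

Lemma computable_npair : computable (fun X n => npair (F X n) (G X n)).
Proof.
have cS := recursive_add cF cG.
exact: recursive_add (recursive_mul cS cS) cF.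
Qed.

Lemma computable_nfst : computable (fun X n => nfst (F X n)).
Proof.
have cS := recursive_isqrt cF.
exact: recursive_sub cF (recursive_mul cS cS).
Qed.

End closure.

Lemma computable_nsnd F : computable F -> computable (fun X n => nsnd (F X n)).
Proof.
by move=> cF; exact: recursive_sub (recursive_isqrt cF) (computable_nfst cF).
Qed.

Section boolean_closure.
Variables (F G : (nat -> bool) -> nat -> nat) (b c : (nat -> bool) -> nat -> bool).
Hypotheses (cF : computable F) (cG : computable G).
Hypotheses (cb : computable (fun X n => b X n)) (cc : computable (fun X n => c X n)).

Lemma computable_leq : computable (fun X n => nat_of_bool (F X n <= G X n)).
Proof.
apply: computable_ext (computable_sub (computable_cst 1) (computable_sub cF cG)) => X n.
by case: leqP => h; lia.
Qed.

Lemma computable_neg : computable (fun X n => nat_of_bool (~~ b X n)).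
Proof.
apply: computable_ext (computable_sub (computable_cst 1) cb) => X n.
by case: (b X n).
Qed.

Lemma computable_and : computable (fun X n => nat_of_bool (b X n && c X n)).
Proof. by apply: computable_ext (computable_mul cb cc) => X n; rewrite mulnb. Qed.

Lemma computable_if : computable (fun X n => if b X n then F X n else G X n).
Proof.
apply: computable_ext (computable_add (computable_mul cb cF)
  (computable_mul (computable_sub (computable_cst 1) cb) cG)) => X n.
by case: (b X n); rewrite ?mul1n ?mul0n ?addn0.
Qed.

End boolean_closure.

Lemma computable_imply (b c : (nat -> bool) -> nat -> bool) :
  computable (fun X n => b X n) -> computable (fun X n => c X n) ->
  computable (fun X n => nat_of_bool (b X n ==> c X n)).
Proof.
move=> cb cc.
apply: computable_ext (computable_neg (computable_and cb (computable_neg cc))) => X n.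
by case: (b X n); case: (c X n).
Qed.

Lemma computable_eq F G : computable F -> computable G ->
  computable (fun X n => nat_of_bool (F X n == G X n)).
Proof.
move=> cF cG.
apply: computable_ext (computable_and (computable_leq cF cG) (computable_leq cG cF)) => X n.
by rewrite eqn_leq.
Qed.

(** The input [n] is the parameter of the recursion; the step reads counter, value and parameter
    from one nested pair and so remains a unary functional. *)
Lemma computable_rec K F G :
  computable K -> computable F ->
  computable (fun X p => G X (nfst p) (nfst (nsnd p)) (nsnd (nsnd p))) ->
  computable (fun X n => nat_rec (fun _ => nat) (F X n)
    (fun k z => G X k z n) (K X n)).
Proof.
move=> cK cF cG.
have r i : @recursive 3 (fun _ v => tnth v i) by exact: recursive_proj.
have cG' : recursive (fun X (v : 3.-tuple nat) =>
    G X (tnth v ord0) (tnth v (inord 1)) (tnth v ord_max)).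
  have pr n f g : @recursive n f -> recursive g -> recursive (fun X v => npair (f X v) (g X v)).
    by move=> rf rg; have S := recursive_add rf rg; exact: recursive_add (recursive_mul S S) rf.
  have := recursive_comp cG (fun=> pr _ _ _ (r ord0) (pr _ _ _ (r (inord 1)) (r ord_max))).
  apply: recursive_ext => X v.
  by rewrite /thead tnth_mktuple !(nfst_npair, nsnd_npair).
pose H (i : 'I_2) X (v : 1.-tuple nat) := if i == ord0 then K X (thead v) else thead v.
have rH i : recursive (H i).
  by rewrite /H; case: (i == ord0); [exact: cK|exact: recursive_proj].
apply: recursive_ext (recursive_comp (recursive_primrec cF cG') rH) => X v.
set w := [tuple H i X v | i < 2].
have -> : w = [tuple K X (thead v); thead v].
  apply: eq_from_tnth => i; rewrite tnth_mktuple /H.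
  by case: i => -[|[|//]] ilt.
rewrite /thead /=; set x := tnth v ord0.
rewrite [in LHS](_ : tnth [tuple K X x; x] ord0 = K X x)//.
by elim: (K X x) => [//|k IH]; rewrite [RHS]/= -IH /tnth /= inordK.
Qed.

Lemma computable_iter K F G : computable K -> computable F ->
  computable (fun X p => G X (nfst p) (nsnd p)) ->
  computable (fun X n => iter (K X n) (fun z => G X z n) (F X n)).
Proof.
move=> cK cF cG.
have cG' : computable (fun X p => G X (nfst (nsnd p)) (nsnd (nsnd p))).
  exact: computable_comp cG (computable_nsnd computable_id).
apply: computable_ext (computable_rec (G := fun X _ z n => G X z n) cK cF cG') => X n.
by elim: (K X n) => //= k ->.
Qed.

Lemma computable_count K (b : (nat -> bool) -> nat -> nat -> bool) : computable K ->
  computable (fun X p => nat_of_bool (b X (nfst p) (nsnd p))) ->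
  computable (fun X n => count (fun k => b X k n) (iota 0 (K X n))).
Proof.
move=> cK cb.
have i := computable_id.
have cG : computable (fun X p => nfst (nsnd p) + b X (nfst p) (nsnd (nsnd p))).
  have := computable_comp cb (computable_npair (computable_nfst i)
    (computable_nsnd (computable_nsnd i))).
  move=> h; apply: computable_add (computable_nfst (computable_nsnd i)) _.
  by apply: computable_ext h => X p; rewrite nfst_npair nsnd_npair.
apply: computable_ext (computable_rec (G := fun X k z n => z + b X k n)
  cK (computable_cst 0) cG) => X n.
elim: (K X n) => // k IH; rewrite [LHS]/= IH -[in RHS]addn1 iotaD count_cat /= add0n; lia.
Qed.

Lemma computable_has K (b : (nat -> bool) -> nat -> nat -> bool) : computable K ->
  computable (fun X p => nat_of_bool (b X (nfst p) (nsnd p))) ->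
  computable (fun X n => nat_of_bool (has (fun k => b X k n) (iota 0 (K X n)))).
Proof.
move=> cK cb.
apply: computable_ext (computable_leq (computable_cst 1) (computable_count cK cb)) => X n.
by rewrite has_count.
Qed.

Lemma computable_all K (b : (nat -> bool) -> nat -> nat -> bool) : computable K ->
  computable (fun X p => nat_of_bool (b X (nfst p) (nsnd p))) ->
  computable (fun X n => nat_of_bool (all (fun k => b X k n) (iota 0 (K X n)))).
Proof.
move=> cK cb.
apply: computable_ext (computable_eq (computable_count cK cb) cK) => X n.
by rewrite all_count size_iota.
Qed.

Lemma computable_exp2 F : computable F -> computable (fun X n => 2 ^ F X n).
Proof.
move=> cF; have i := computable_nfst computable_id.
apply: computable_ext (computable_iter (G := fun _ z _ => z + z) cF (computable_cst 1)
  (computable_add i i)) => X n.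
by elim: (F X n) => //= k ->; rewrite expnS mul2n addnn.
Qed.

Definition nbit t i := odd (t %/ 2 ^ i).

Lemma computable_half F : computable F -> computable (fun X n => (F X n)./2).
Proof.
move=> cF.
have c : computable (fun X p => nfst p - nfst (nsnd p)).
  apply: computable_sub; first exact: computable_nfst computable_id.
  exact: computable_nfst (computable_nsnd computable_id).
(* The recursion rests on [k.+1./2 = k - k./2]. *)
apply: computable_ext (computable_rec (G := fun _ k z _ => k - z) cF (computable_cst 0) c) => X n.
elim: (F X n) => // k /= ->; rewrite uphalf_half; lia.
Qed.

Lemma computable_nbit F G : computable F -> computable G ->
  computable (fun X n => nat_of_bool (nbit (F X n) (G X n))).
Proof.
move=> cF cG; pose T X n := iter (G X n) half (F X n).
have cT : computable T.
  exact: (computable_iter (G := fun _ z _ => z./2) cG cF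
    (computable_half (computable_nfst computable_id))).
have ch := computable_half cT.
apply: computable_ext (computable_sub cT (computable_add ch ch)) => X n.
have -> : T X n = F X n %/ 2 ^ G X n.
  rewrite /T; elim: (G X n) => [|k /= ->]; first by rewrite expn0 divn1.
  by rewrite -divn2 -divnMA -expnSr.
rewrite /nbit; lia.
Qed.

(** The lowest bit comes first, so a longer prefix keeps the bits of a shorter one. *)
Definition prefix_code (X : nat -> bool) s :=
  nat_rec (fun _ => nat) 0 (fun k z => z + X k * 2 ^ k) s.

Lemma computable_prefix F : computable F -> computable (fun X n => prefix_code X (F X n)).
Proof.
move=> cF; apply: (computable_rec (G := fun X k z _ => z + X k * 2 ^ k)) => //.
  exact: computable_cst.
have i1 := computable_nfst computable_id.
have i2 := computable_nfst (computable_nsnd computable_id).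
apply: computable_add i2 (computable_mul (computable_oracle i1) (computable_exp2 i1)).
Qed.

Lemma ltn_prefix_code X s : prefix_code X s < 2 ^ s.
Proof. by elim: s => //= s IH; rewrite expnS; case: (X s); lia. Qed.

Lemma nbit_prefix_code X s i : i < s -> nbit (prefix_code X s) i = X i.
Proof.
elim: s => //= s IH; rewrite ltnS leq_eqVlt => /orP[/eqP ->|lt_is].
  rewrite /nbit addnC divnMDl ?expn_gt0// divn_small ?ltn_prefix_code// addn0.
  by case: (X s).
rewrite -IH// /nbit -(subnK (ltnW lt_is)) expnD mulnA addnC divnMDl ?expn_gt0//.
by rewrite oddD oddM oddX subn_eq0 leqNgt lt_is andbF.
Qed.

Ltac computable_step :=
  lazymatch goal with
  | |- computable (fun _ x => x) => exact: computable_id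
  | |- computable (fun _ _ => ?k) => exact: (computable_cst k)
  | |- computable (fun X x => S (@?a X x)) => apply: (computable_succ (F := a))
  | |- computable (fun X x => addn (@?a X x) (@?b X x)) =>
      apply: (computable_add (F := a) (G := b))
  | |- computable (fun X x => subn (@?a X x) (@?b X x)) =>
      apply: (computable_sub (F := a) (G := b))
  | |- computable (fun X x => muln (@?a X x) (@?b X x)) =>
      apply: (computable_mul (F := a) (G := b))
  | |- computable (fun X x => predn (@?a X x)) => apply: (computable_pred (F := a))
  | |- computable (fun X x => npair (@?a X x) (@?b X x)) =>
      apply: (computable_npair (F := a) (G := b))
  | |- computable (fun X x => nfst (@?a X x)) => apply: (computable_nfst (F := a))
  | |- computable (fun X x => nsnd (@?a X x)) => apply: (computable_nsnd (F := a))
  | |- computable (fun X x => prefix_code X (@?a X x)) =>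
      apply: (computable_prefix (F := a))
  | |- computable (fun X x => expn 2 (@?a X x)) => apply: (computable_exp2 (F := a))
  | |- computable (fun X x => nat_of_bool (leq (@?a X x) (@?b X x))) =>
      apply: (computable_leq (F := a) (G := b))
  | |- computable (fun X x => nat_of_bool (eq_op (@?a X x) (@?b X x))) =>
      apply: (computable_eq (F := a) (G := b))
  | |- computable (fun X x => nat_of_bool (andb (@?a X x) (@?b X x))) =>
      apply: (computable_and (b := a) (c := b))
  | |- computable (fun X x => nat_of_bool (negb (@?a X x))) =>
      apply: (computable_neg (b := a))
  | |- computable (fun X x => nat_of_bool (implb (@?a X x) (@?b X x))) =>
      apply: (computable_imply (b := a) (c := b))
  | |- computable (fun X x => nat_of_bool (nbit (@?a X x) (@?b X x))) =>
      apply: (computable_nbit (F := a) (G := b))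
  | |- computable (fun _ _ => if _ then _ else _) => apply: computable_if
  end.
Ltac computability := repeat computable_step.

(** * A universal stack machine *)

Opaque npair nfst nsnd.
Arguments npair : simpl never.
Arguments nfst : simpl never.
Arguments nsnd : simpl never.

Definition push i K x := npair (npair i K) x.

(* A state [<<i, K>, x>] has value [x] and the stack of instructions [<i, K>]; an instruction
   is a pair of an opcode and an argument.  Opcodes 7 and 8 continue the pairing 6, 8 also
   the loop 10, and 12 the search 11.  Opcode 0 halts; since [0 = <0, 0>] the empty stack
   [0] halts as well.  [o] is [0] when the oracle query [x] is unanswered. *)
Definition execute (o st tag a K x : nat) :=
  if tag == 1 then npair K 0
  else if tag == 2 then npair K x.+1
  else if tag == 3 then if o == 0 then st else npair K o.-1
  else if tag == 4 then npair K (nfst x)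
  else if tag == 5 then npair K (nsnd x)
  else if tag == 6 then
    push (nfst a) (npair (npair 7 (npair (nsnd a) x)) K) x
  else if tag == 7 then push (nfst a) (npair (npair 8 x) K) (nsnd a)
  else if tag == 8 then npair K (npair a x)
  else if tag == 9 then push (nsnd a) (npair (nfst a) K) x
  else if tag == 10 then
    if nfst x == 0 then npair K (nsnd x)
    else push a (npair (npair 8 (nfst x).-1) (npair (npair tag a) K)) (nsnd x)
  else if tag == 11 then push a (npair (npair 12 (npair a x)) K) x
  else if tag == 12 then
    if x == 0 then npair K (nfst (nsnd a))
    else push (npair 11 (nfst a)) K (npair (nfst (nsnd a)).+1 (nsnd (nsnd a)))
  else st.

Definition machine_step o st :=
  execute o st (nfst (nfst (nfst st))) (nsnd (nfst (nfst st))) (nsnd (nfst st)) (nsnd st).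

Lemma machine_step_push o tag a K x :
  machine_step o (npair (npair (npair tag a) K) x)
  = execute o (npair (npair (npair tag a) K) x) tag a K x.
Proof. by rewrite /machine_step !(nfst_npair, nsnd_npair). Qed.

Lemma computable_machine_step F G : computable F -> computable G ->
  computable (fun X n => machine_step (F X n) (G X n)).
Proof.
move=> cF cG; rewrite /machine_step /execute /push.
by repeat first [computable_step | exact: cF | exact: cG].
Qed.

Definition run (q : nat -> nat) t st := iter t (fun z => machine_step (q (nsnd z)) z) st.

Lemma runSr q t st : run q t.+1 st = run q t (machine_step (q (nsnd st)) st).
Proof. exact: iterSr. Qed.

Lemma runD q t t' st : run q (t + t') st = run q t (run q t' st).
Proof. exact: iterD. Qed.

Definition steps_to q st st' := exists t, run q t st = st'.

Section machine.
Variable q : nat -> nat.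

Lemma steps_to_refl st : steps_to q st st. Proof. by exists 0. Qed.

Lemma steps_to_trans st1 st2 st3 :
  steps_to q st1 st2 -> steps_to q st2 st3 -> steps_to q st1 st3.
Proof. by move=> [t1 <-] [t2 <-]; exists (t2 + t1); rewrite runD. Qed.

Lemma steps_to_step st st' :
  steps_to q (machine_step (q (nsnd st)) st) st' -> steps_to q st st'.
Proof. by apply: steps_to_trans; exists 1. Qed.

(** Quantifying over the rest [K] of the stack lets these specifications be chained. *)
Definition runs e x y := forall K, steps_to q (push e K x) (npair K y).

Ltac machine_step1 := apply: steps_to_step;
  rewrite /push machine_step_push /execute /= ?(nfst_npair, nsnd_npair) /=.

Lemma runs_zero x : runs (npair 1 0) x 0.
Proof. by move=> K; machine_step1; exact: steps_to_refl. Qed.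

Lemma runs_succ x : runs (npair 2 0) x x.+1.
Proof. by move=> K; machine_step1; exact: steps_to_refl. Qed.

Lemma runs_oracle x y : q x = y.+1 -> runs (npair 3 0) x y.
Proof. by move=> qx K; machine_step1; rewrite qx; exact: steps_to_refl. Qed.

Lemma runs_fst x : runs (npair 4 0) x (nfst x).
Proof. by move=> K; machine_step1; exact: steps_to_refl. Qed.

Lemma runs_snd x : runs (npair 5 0) x (nsnd x).
Proof. by move=> K; machine_step1; exact: steps_to_refl. Qed.

Definition pair_op t u := npair 6 (npair t u).

Lemma runs_pair t u x a b : runs t x a -> runs u x b -> runs (pair_op t u) x (npair a b).
Proof.
move=> ta ub K; machine_step1; apply: steps_to_trans (ta _) _; machine_step1.
by apply: steps_to_trans (ub _) _; machine_step1; exact: steps_to_refl.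
Qed.

Definition comp_op t u := npair 9 (npair t u).

Lemma runs_comp t u x y z : runs u x y -> runs t y z -> runs (comp_op t u) x z.
Proof. by move=> uy tz K; machine_step1; apply: steps_to_trans (uy _) (tz _). Qed.

Definition rep_op t := npair 10 t.

Lemma runs_rep0 t a : runs (rep_op t) (npair 0 a) a.
Proof. by move=> K; machine_step1; exact: steps_to_refl. Qed.

Lemma runs_repS t r a b c :
  runs t a b -> runs (rep_op t) (npair r b) c -> runs (rep_op t) (npair r.+1 a) c.
Proof.
move=> tb rc K; machine_step1; apply: steps_to_trans (tb _) _; machine_step1.
exact: rc.
Qed.

Definition mu_op t := npair 11 t.

Lemma runs_mu0 t y v : runs t (npair y v) 0 -> runs (mu_op t) (npair y v) y.
Proof.
move=> t0 K; machine_step1; apply: steps_to_trans (t0 _) _; machine_step1.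
exact: steps_to_refl.
Qed.

Lemma runs_muS t y v k z : runs t (npair y v) k.+1 ->
  runs (mu_op t) (npair y.+1 v) z -> runs (mu_op t) (npair y v) z.
Proof.
move=> tk mz K; machine_step1; apply: steps_to_trans (tk _) _; machine_step1.
exact: mz.
Qed.

End machine.

(** * Compilation of recursive codes to machine expressions *)

Notation encode := (foldr npair 0).

(** The pairing is not surjective, so this fails for arbitrary numbers; the empty list is covered by
    [npair 0 0 = 0]. *)
Lemma npair_eta s : npair (nfst (encode s)) (nsnd (encode s)) = encode s.
Proof. by case: s => //= a s; rewrite nfst_npair nsnd_npair. Qed.

Lemma runs_proj i : exists e, forall q s, runs q e (encode s) (nth 0 s i).
Proof.
elim: i => [|i [e He]].
  exists (npair 4 0) => q s; have := runs_fst q (encode s).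
  by case: s => //= a s; rewrite nfst_npair.
exists (comp_op e (npair 5 0)) => q s; apply: runs_comp; first exact: runs_snd.
by have := He q (behead s); case: s => [|a s] /=; rewrite ?nsnd_npair ?nth_nil.
Qed.

Lemma runs_encode q es ys x : size es = size ys ->
  (forall i, i < size es -> runs q (nth 0 es i) x (nth 0 ys i)) ->
  runs q (foldr pair_op (npair 1 0) es) x (encode ys).
Proof.
elim: es ys => [|e es IH] [|y ys] //= => [_ _|[eq_sz] H]; first exact: runs_zero.
apply: runs_pair; first exact: (H 0).
by apply: IH => // i i_lt; exact: (H i.+1).
Qed.

Definition oracle_answer (X : nat -> bool) x := (X x).+1.

Lemma eval_primrec X n (f : recursive_code n) (g : recursive_code n.+2) k (v : n.-tuple nat) y :
  Defs.eval X (PrimRec f g) [tuple of k :: v] y ->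
  (fix rec k y := match k with
    | 0 => Defs.eval X f v y
    | k.+1 => exists z, rec k z /\ Defs.eval X g [tuple of k :: z :: v] y
    end) k y.
Proof.
have E : [tuple of behead [tuple of k :: v]] = v by exact: val_inj.
rewrite /Defs.eval -/Defs.eval theadE; move: E; set w := [tuple of k :: v]; clearbody w => <-.
exact id.
Qed.

(** The expression depends on the code alone, so natural numbers index the functionals at all
    oracles simultaneously; the final measure argument uses that there are countably many
    indices. *)
Lemma compile n (c : recursive_code n) : exists e, forall X v y,
  Defs.eval X c v y -> runs (oracle_answer X) e (encode v) y.
Proof.
elim: c => {n} [n|||n i|m n f [ef Hf] g /boolp.choice[eg Hg]|n f [ef Hf] g [eg Hg]|n f [ef Hf]].
- by exists (npair 1 0) => X v _ ->; exact: runs_zero.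
- exists (comp_op (npair 2 0) (npair 4 0)) => X v _ ->.
  apply: runs_comp (runs_fst _ _) _; case/tupleP: v => a v.
  by rewrite /= nfst_npair theadE; exact: runs_succ.
- exists (comp_op (npair 3 0) (npair 4 0)) => X v _ ->.
  apply: runs_comp (runs_fst _ _) _; case/tupleP: v => a v.
  by rewrite /= nfst_npair theadE; exact: runs_oracle.
- have [e He] := runs_proj i; exists e => X v _ ->.
  by rewrite (tnth_nth 0); exact: He.
- exists (comp_op ef (foldr pair_op (npair 1 0) [seq eg i | i <- enum 'I_m])) => X v y [w [gw fw]].
  apply: runs_comp (Hf _ _ _ fw); apply: runs_encode;
    rewrite size_map size_enum_ord ?size_tuple// => i lt_im.
  have -> : nth 0 [seq eg j | j <- enum 'I_m] i = eg (Ordinal lt_im).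
    by rewrite (nth_map (Ordinal lt_im)) ?size_enum_ord// (nth_ord_enum _ (Ordinal lt_im)).
  by have := Hg _ _ _ _ (gw (Ordinal lt_im)); rewrite (tnth_nth 0).
- pose fst_op := npair 4 0; pose snd_op := npair 5 0.
  (* The loop state is [<<j, z>, v>], with [z] the value of the recursion at [j]. *)
  pose start := pair_op fst_op (pair_op (pair_op (npair 1 0) (comp_op ef snd_op)) snd_op).
  pose j_op := comp_op fst_op fst_op.
  pose body := pair_op (pair_op (comp_op (npair 2 0) j_op)
    (comp_op eg (pair_op j_op (pair_op (comp_op snd_op fst_op) snd_op)))) snd_op.
  exists (comp_op (comp_op snd_op fst_op) (comp_op (rep_op body) start)) => X v.
  case/tupleP: v => k v y /eval_primrec rec_y.
  pose q := oracle_answer X; pose st j z := npair (npair j z) (encode v).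
  (* The recursion unfolds from [k] downwards while the loop runs from [0] upwards; allowing [r]
     further iterations after the first [k] makes the induction pass. *)
  have [f0 [ef0 Hrec]] : exists f0, runs q ef (encode v) f0 /\
      forall r c, runs q (rep_op body) (npair r (st k y)) c ->
      runs q (rep_op body) (npair (r + k) (st 0 f0)) c.
    elim: k y rec_y => [|k IH] y /=.
      move=> /Hf fy; exists y; split; first exact: fy.
      by move=> r c rc; rewrite addn0; exact: rc.
    move=> [z [rec_z gz]]; have [f0 [ef0 Hf0]] := IH z rec_z.
    exists f0; split; [exact: ef0|move=> r c rc].
    rewrite addnS -addSn; apply: Hf0; apply: runs_repS rc.
    have run_j : runs q j_op (st k z) k.
      apply: runs_comp (runs_fst _ _) _; rewrite nfst_npair.
      by have := runs_fst q (npair k z); rewrite nfst_npair.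
    have run_v : runs q snd_op (st k z) (encode v).
      by have := runs_snd q (st k z); rewrite nsnd_npair.
    have run_z : runs q (comp_op snd_op fst_op) (st k z) z.
      apply: runs_comp (runs_fst _ _) _; rewrite nfst_npair.
      by have := runs_snd q (npair k z); rewrite nsnd_npair.
    apply: (runs_pair _ run_v); apply: runs_pair; first exact: runs_comp run_j (runs_succ _ _).
    apply: runs_comp (Hg _ _ _ gz).
    exact: runs_pair run_j (runs_pair run_z run_v).
  apply: (runs_comp (y := st k y)); last first.
    apply: runs_comp (runs_fst _ _) _; rewrite nfst_npair.
    by have := runs_snd q (npair k y); rewrite nsnd_npair.
  apply: (runs_comp (y := npair k (st 0 f0))); last exact: Hrec (runs_rep0 _ _ _).
  have run_v : runs q snd_op (npair k (encode v)) (encode v).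
    by have := runs_snd q (npair k (encode v)); rewrite nsnd_npair.
  apply: runs_pair; first by have := runs_fst q (npair k (encode v)); rewrite nfst_npair.
  apply: (runs_pair _ run_v); apply: runs_pair; first exact: runs_zero.
  exact: runs_comp run_v ef0.
- exists (comp_op (mu_op ef) (pair_op (npair 1 0) (pair_op (npair 4 0) (npair 5 0)))).
  move=> X v y [fy0 fylt].
  apply: (runs_comp (y := npair 0 (encode v))).
    apply: runs_pair; first exact: runs_zero.
    by rewrite -{2}(npair_eta v); exact: runs_pair (runs_fst _ _) (runs_snd _ _).
  (* Induction on the distance [d] from the answer, as the search counts upwards. *)
  suff H d : d <= y -> runs (oracle_answer X) (mu_op ef) (npair (y - d) (encode v)) y.
    by have := H y (leqnn y); rewrite subnn.
  elim: d => [|d IH] ltdy; first by rewrite subn0; exact: runs_mu0 (Hf _ _ _ fy0).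
  have [|k fk] := fylt (y - d.+1); first by lia.
  apply: runs_muS (Hf _ _ _ fk) _.
  by rewrite subnSK//; exact: IH (ltnW ltdy).
Qed.

(** * Step-bounded runs on finite oracles *)

Definition halted st := nfst (nfst (nfst st)) == 0.

Lemma run_halted q t st : halted st -> run q t st = st.
Proof.
move=> /eqP h; elim: t => //= t ->.
by rewrite /machine_step h.
Qed.

(* An unanswered query blocks the machine, so a run under a partial oracle
   that halts never used a missing answer. *)
Lemma run_partial_oracle q q' t st :
  (forall x, q x != 0 -> q' x = q x) -> halted (run q t st) ->
  run q' t st = run q t st.
Proof.
move=> qq'; elim: t st => [st _|t IH st]; first reflexivity.
rewrite !runSr.
set st1 := machine_step (q _) st.
have [->|st1E] : machine_step (q' (nsnd st)) st = st1 \/ st1 = st.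
- have [q0|/qq' ->] := eqVneq (q (nsnd st)) 0; last by left.
  rewrite /st1 q0 /machine_step /execute.
  have [tag3|_] := eqVneq (nfst (nfst (nfst st))) 3; last by left.
  by right; rewrite tag3.
- exact: IH.
(* An unanswered query repeats [st] forever, so the halted final state is [st] itself, and no oracle
   moves it. *)
- rewrite st1E => h; have hst : halted st.
    suff E : run q t st = st by rewrite -E.
    by elim: t {IH h} => //= t ->.
  have := run_halted q' t.+1 hst; rewrite runSr => ->.
  by rewrite run_halted.
Qed.

Definition string_answer w s x := if x < s then (nbit w x).+1 else 0.

(** The use principle: [s0] exceeds the value of every state from which one of the [t] steps is
    taken, hence every query. *)
Lemma run_long_prefix X t st : exists s0, forall s, s0 <= s ->
  run (string_answer (prefix_code X s) s) t st = run (oracle_answer X) t st.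
Proof.
elim: t => [|t [s0 Hs0]]; first by exists 0.
exists (maxn s0 (nsnd (run (oracle_answer X) t st)).+1) => s.
rewrite geq_max => /andP[le_s0 lt_s] /=.
have E := Hs0 s le_s0; rewrite /run in E *; rewrite E.
by rewrite /string_answer lt_s nbit_prefix_code.
Qed.

(* The value [y.+1] stands for the output [y], and [0] for no output within [s] steps. *)
Definition bounded_run e w n s :=
  let st := run (string_answer w s) s (npair (npair e 0) (npair n 0)) in
  if halted st && (nsnd st <= s) then (nsnd st).+1 else 0.

(** This is why [bounded_run] compares the output with [s]: a stage then bounds all values found by
    it. *)
Lemma bounded_run_leq e w n s y : bounded_run e w n s = y.+1 -> y <= s.
Proof. by rewrite /bounded_run; case: ifP => // /andP[_ ?] [<-]. Qed.

(** A longer prefix answers the earlier queries in the same way, and further steps leave a halted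
    state alone. *)
Lemma bounded_run_mono X e n s s' y : s <= s' ->
  bounded_run e (prefix_code X s) n s = y.+1 -> bounded_run e (prefix_code X s') n s' = y.+1.
Proof.
move=> le_ss'; rewrite /bounded_run; set st := npair _ _.
case: ifP => // /andP[h le_s] [<-].
pose q s := string_answer (prefix_code X s) s.
have E : run (q s') s' st = run (q s) s st.
  have E1 : run (q s') s st = run (q s) s st.
    apply: run_partial_oracle h => x; rewrite /q /string_answer.
    case: ifP => // lt_xs _; rewrite (leq_trans lt_xs le_ss').
    by rewrite !nbit_prefix_code// (leq_trans lt_xs).
  rewrite -{2}(subnK le_ss') runD.
  by rewrite E1 run_halted.
by rewrite -/(q s') E h (leq_trans le_s).
Qed.

Lemma bounded_run_complete (c : recursive_code 1) : exists e, forall X n y,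
  Defs.eval X c [tuple n] y -> exists s, bounded_run e (prefix_code X s) n s = y.+1.
Proof.
have [e He] := compile c; exists e => X n y /He /(_ 0)[t Et].
have [s0 Hs0] := run_long_prefix X t (push e 0 (npair n 0)).
(* [s] bounds the use, the number of steps and the output at once. *)
pose s := maxn s0 (maxn t y); exists s; rewrite /bounded_run -[npair _ (npair n 0)]/(push e 0 _).
have -> : run (string_answer (prefix_code X s) s) s (push e 0 (npair n 0)) = npair 0 y.
  have le_ts : t <= s by rewrite !leq_max leqnn orbT.
  rewrite -{3}(subnK le_ts) runD Hs0 ?leq_maxl// Et.
  by rewrite run_halted// /halted nfst_npair.
by rewrite /halted nfst_npair nsnd_npair !leq_max leqnn !orbT.
Qed.

Lemma computable_bounded_run E W N S :
  computable E -> computable W -> computable N -> computable S ->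
  computable (fun X n => bounded_run (E X n) (W X n) (N X n) (S X n)).
Proof.
move=> cE cW cN cS.
pose R X n := run (string_answer (W X n) (S X n)) (S X n)
  (npair (npair (E X n) 0) (npair (N X n) 0)).
have cR : computable R.
  apply: (computable_iter (G := fun X z n =>
    machine_step (string_answer (W X n) (S X n) (nsnd z)) z)) => //.
    by repeat first [computable_step | exact: cE | exact: cN].
  have cS' := computable_comp cS (computable_nsnd computable_id).
  have cW' := computable_comp cW (computable_nsnd computable_id).
  apply: computable_machine_step; last by computability.
  by rewrite /string_answer; repeat first [computable_step | exact: cS' | exact: cW'].
rewrite /bounded_run /halted.
apply: (computable_if (b := fun X n => (nfst (nfst (nfst (R X n))) == 0) && (nsnd (R X n) <= S X n))
  (F := fun X n => (nsnd (R X n)).+1) (G := fun _ _ => 0)).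
- by repeat first [computable_step | exact: cR | exact: cS].
- by repeat first [computable_step | exact: cR].
- by computability.
Qed.

(** * Risking measure *)

(** [Mu] looks for a zero, hence the negation of [b]. The code is specified only where a least
    witness exists. *)
Lemma computable_minimization (b : (nat -> bool) -> nat -> nat -> bool) :
  computable (fun X p => nat_of_bool (b X (nfst p) (nsnd p))) ->
  exists c : recursive_code 1, forall X n y, b X y n -> (forall z, z < y -> ~~ b X z n) ->
    Defs.eval X c [tuple n] y.
Proof.
move=> cb.
have rp : recursive (fun _ (v : 2.-tuple nat) => npair (tnth v ord0) (tnth v (inord 1))).
  have r0 := recursive_proj (ord0 : 'I_2); have r1 := recursive_proj (inord 1 : 'I_2).
  have rs := recursive_add r0 r1.
  exact: recursive_add (recursive_mul rs rs) r0.
have [c Hc] := recursive_comp (computable_neg cb) (fun=> rp).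
exists (Mu c) => X n y byn bz /=.
have E z : Defs.eval X c [tuple of z :: [tuple n]] (~~ b X z n).
  have := Hc X [tuple of z :: [tuple n]].
  by rewrite /thead tnth_mktuple nfst_npair nsnd_npair /tnth /= inordK.
split; first by have := E y; rewrite byn.
by move=> z /bz nbz; exists 0; have := E z; rewrite nbz.
Qed.

Section attacks.
(** [T E n s] reads: the search [E] at argument [n] succeeds at stage [s]. *)
Variable T : nat -> nat -> nat -> bool.

(* For [E <= n]: the last argument [m <= n] at which an attack against [E] started, and the
   number of earlier attacks, all of which succeeded; the first attack is at [m = E]. *)
Definition stage E n := nat_rec (fun _ => nat) (npair 0 0)
  (fun k z => if k.+1 <= E then npair k.+1 0
    else if has (fun s => T E (nfst z) s) (iota 0 k.+1) then npair k.+1 (nsnd z).+1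
    else z) n.

Definition attacks E n := nfst (stage E n) == n.

(** Attacks with distinct numbers are carried by disjoint cylinders; a number of at least [2 ^ E.+2]
    belongs to no [X]. *)
Definition active X E n := attacks E n && (nsnd (stage E n) == prefix_code X E.+2).

(** The least such [t] will be the value at [n]: it bounds a successful stage of each search that
    [X] attacks there. *)
Definition ready X t n := all (fun E => active X E n ==> has (fun s => T E n s) (iota 0 t.+1))
  (iota 0 n.+1).

Lemma stageS E n : E <= n -> stage E n.+1 =
  if has (fun s => T E (nfst (stage E n)) s) (iota 0 n.+1)
  then npair n.+1 (nsnd (stage E n)).+1 else stage E n.
Proof. by rewrite /= ltnNge => ->. Qed.

Lemma stage_start E : stage E E = npair E 0.
Proof. by case: E => //= E; rewrite leqnn. Qed.

(** A search that never succeeds freezes the recursion, so the attack waiting for it is the last. *)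
Lemma stuck_attack E n1 n2 : E <= n1 -> attacks E n1 -> (forall s, ~~ T E n1 s) ->
  n1 < n2 -> ~~ attacks E n2.
Proof.
move=> leE /eqP att nT lt_n; rewrite /attacks.
suff -> : nfst (stage E n2) = n1 by rewrite neq_ltn lt_n.
move: (ltnW lt_n) => {lt_n}; elim: n2 => [|n IH]; first by rewrite leqn0 => /eqP <-.
rewrite leq_eqVlt => /orP[/eqP <-//|]; rewrite ltnS => le_n.
rewrite stageS ?(leq_trans leE)// IH// ifF ?IH//.
by apply/hasP => -[s _]; rewrite (negbTE (nT s)).
Qed.

Lemma next_attack E n : E <= n -> attacks E n -> (exists s, T E n s) ->
  exists n', [/\ n < n', attacks E n' & nsnd (stage E n') = (nsnd (stage E n)).+1].
Proof.
move=> leE /eqP att exT; pose s0 := ex_minn exT.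
have [Ts0 s0_min] : T E n s0 /\ forall s, T E n s -> s0 <= s.
  by rewrite /s0; case: ex_minnP.
have H m : n <= m <= maxn n s0 -> stage E m = stage E n.
  elim: m => [|m IH] /andP[]; first by rewrite leqn0 => /eqP ->.
  rewrite leq_eqVlt => /orP[/eqP ->//|]; rewrite ltnS => le_nm lt_m.
  rewrite stageS ?(leq_trans leE)// IH ?le_nm ?(ltnW lt_m)// ifF// att.
  apply/hasP => -[s]; rewrite mem_iota => s_lt /s0_min; lia.
(* The step from [k] to [k.+1] inspects the stages up to [k], so [s0] is first seen at
   [k = maxn n s0] and the new attack starts one argument later. *)
exists (maxn n s0).+1; split; first by rewrite ltnS leq_maxl.
  rewrite /attacks stageS ?leq_max ?leE// ifT ?nfst_npair// H ?leq_maxl ?leqnn// att.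
  by apply/hasP; exists s0 => //; rewrite mem_iota /= add0n ltnS leq_maxr.
rewrite stageS ?leq_max ?leE// ifT ?nsnd_npair H ?leq_maxl ?leqnn// att.
by apply/hasP; exists s0 => //; rewrite mem_iota /= add0n ltnS leq_maxr.
Qed.

Lemma exists_attack E w : (forall n, E <= n -> exists s, T E n s) ->
  exists n, [/\ E <= n, attacks E n & nsnd (stage E n) = w].
Proof.
move=> exT; elim: w => [|w [n [leE att <-]]].
  by exists E; rewrite /attacks stage_start nfst_npair nsnd_npair.
have [n' [lt_n att' E']] := next_attack leE att (exT n leE).
by exists n'; split => //; rewrite (leq_trans leE) // ltnW.
Qed.

Definition bad E X := exists n, [/\ E <= n, active X E n & forall s, ~~ T E n s].

(** A stuck attack is the last one, so all bad [X] are stuck in the same attack and share the prefix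
    coding its number. *)
Lemma bad_sub E : exists w, forall X, bad E X -> prefix_code X E.+2 = w.
Proof.
have [[X0 bad0]|nbad] := pselect (exists X, bad E X); last first.
  by exists 0 => X bX; case: nbad; exists X.
exists (prefix_code X0 E.+2) => X [n [leE /andP[att /eqP <-] nT]].
case: bad0 => n0 [leE0 /andP[att0 /eqP <-] nT0].
have [lt_n|lt_n|-> //] := ltngtP n n0.
- by have := stuck_attack leE att nT lt_n; rewrite att0.
- by have := stuck_attack leE0 att0 nT0 lt_n; rewrite att.
Qed.

Lemma exists_ready X n : (forall E, ~ bad E X) -> exists t, ready X t n.
Proof.
move=> good.
have H E : exists t, E <= n -> active X E n -> has (fun s => T E n s) (iota 0 t.+1).
  have [[leE act]|h] := pselect (E <= n /\ active X E n); last first.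
    by exists 0 => leE act; case: h.
  have [s Ts] : exists s, T E n s.
    apply: contrapT => nT; apply: (good E); exists n; split=> // s.
    by apply/negP => Ts; apply: nT; exists s.
  by exists s => _ _; apply/hasP; exists s => //; rewrite mem_iota add0n ltnSn.
have [f Hf] := boolp.choice H.
exists (\max_(E < n.+1) f E); apply/allP => E; rewrite mem_iota add0n ltnS => leE.
apply/implyP => act; have /hasP[s + Ts] := Hf E leE act.
rewrite mem_iota add0n ltnS => s_le; apply/hasP; exists s => //.
rewrite mem_iota add0n ltnS (leq_trans s_le)//.
have ltE : E < n.+1 by rewrite ltnS.
exact: (leq_bigmax (F := fun E : 'I_n.+1 => f E) (Ordinal ltE)).
Qed.

(** When all searches succeed, the attack numbered by the prefix of [X] does take place; there [X]
    is active and [g] waits for the search. *)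
Lemma ready_witness X (g : nat -> nat) E : (forall n, ready X (g n) n) ->
  (forall n, E <= n -> exists s, T E n s) ->
  exists n s, [/\ E <= n, s <= g n & T E n s].
Proof.
move=> rg exT; have [n [leE att En]] := exists_attack (prefix_code X E.+2) exT.
have /allP /(_ E) := rg n; rewrite mem_iota add0n ltnS leE => /(_ isT)/implyP.
rewrite /active att En eqxx => /(_ isT)/hasP[s + Ts].
by rewrite mem_iota add0n ltnS => les; exists n, s.
Qed.

Hypothesis computable_T : forall E N S, computable E -> computable N -> computable S ->
  computable (fun X n => nat_of_bool (T (E X n) (N X n) (S X n))).

Lemma computable_stage F G : computable F -> computable G ->
  computable (fun X n => stage (F X n) (G X n)).
Proof.
move=> cF cG.
apply: (computable_rec (G := fun X k z n => if k.+1 <= F X n then npair k.+1 0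
    else if has (fun s => T (F X n) (nfst z) s) (iota 0 k.+1) then npair k.+1 (nsnd z).+1
    else z)) => //; first exact: computable_cst.
have cF' : computable (fun X p => F X (nsnd (nsnd p))).
  by apply: (computable_comp cF); computability.
apply: computable_if; [by computability| |by repeat first [computable_step|exact: cF']].
apply: computable_if; [by computability..|].
apply: (computable_has (b := fun X s p => T (F X (nsnd (nsnd p))) (nfst (nfst (nsnd p))) s)).
  by computability.
apply: computable_T; [|by computability..].
by apply: (computable_comp cF'); computability.
Qed.

Lemma computable_ready : computable (fun X p => nat_of_bool (ready X (nfst p) (nsnd p))).
Proof.
apply: (computable_all (b := fun X E p => active X E (nsnd p) ==>
  has (fun s => T E (nsnd p) s) (iota 0 (nfst p).+1))); first by computability.
apply: (computable_imply (b := fun X p => active X (nfst p) (nsnd (nsnd p)))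
  (c := fun X p => has (fun s => T (nfst p) (nsnd (nsnd p)) s) (iota 0 (nfst (nsnd p)).+1))).
  rewrite /active /attacks.
  by repeat first [computable_step|apply: computable_stage].
apply: (computable_has (b := fun X s p => T (nfst p) (nsnd (nsnd p)) s)).
  by computability.
by apply: computable_T; computability.
Qed.

(** One code serves all [X]; recording minimality pins the value down by a condition that does not
    mention evaluation. *)
Lemma escaping_functional : exists c : recursive_code 1, forall X, (forall E, ~ bad E X) ->
  exists g : nat -> nat, forall n, [/\ Defs.eval X c [tuple n] (g n), ready X (g n) n &
    forall z, z < g n -> ~~ ready X z n].
Proof.
have [c Hc] := computable_minimization computable_ready.
exists c => X good; have ex n := exists_ready n good.
exists (fun n => ex_minn (ex n)) => n; case: ex_minnP => m rm m_min.
have lt_m z : z < m -> ~~ ready X z n.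
  by move=> lt_zm; apply/negP => /m_min; rewrite leqNgt lt_zm.
by split=> //; exact: Hc.
Qed.

End attacks.

(** * The search for many oracle prefixes on which a program halts *)

Definition total_upto e w n s := all (fun k => bounded_run e w k s != 0) (iota 0 n.+1).

(* [E] codes a program, a rational [a / b.+1], and padding that makes [E] large. *)
Definition program E := nfst (nfst E).

(** The inequality [a / b.+1 <= c / 2 ^ s], with [c] the number of good prefixes of length [s],
    cleared of denominators so that it is decidable. *)
Definition often_total E n s := nsnd (nfst E) * 2 ^ s <=
  (nfst (nsnd E)).+1 * count (fun w => total_upto (program E) w n s) (iota 0 (2 ^ s)).

Lemma computable_often_total E N S : computable E -> computable N -> computable S ->
  computable (fun X n => nat_of_bool (often_total (E X n) (N X n) (S X n))).
Proof.
move=> cE cN cS.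
have cE' := computable_comp cE (computable_nsnd computable_id).
have cN' := computable_comp cN (computable_nsnd computable_id).
have cS' := computable_comp cS (computable_nsnd computable_id).
rewrite /often_total.
have cC : computable (fun X n => count (fun w => total_upto (program (E X n)) w (N X n) (S X n))
    (iota 0 (2 ^ S X n))).
  apply: (computable_count (b := fun X w n => total_upto (program (E X n)) w (N X n) (S X n))).
    exact: computable_exp2.
  apply: (computable_all (b := fun X k p =>
    bounded_run (program (E X (nsnd p))) (nfst p) k (S X (nsnd p)) != 0)).
    exact: computable_succ.
  have cE'' := computable_comp cE' (computable_nsnd computable_id).
  have cS'' := computable_comp cS' (computable_nsnd computable_id).
  apply: (computable_neg (b := fun X p => bounded_run (program (E X (nsnd (nsnd p))))
    (nfst (nsnd p)) (nfst p) (S X (nsnd (nsnd p))) == 0)).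
  apply: computable_eq; last exact: computable_cst.
  apply: computable_bounded_run => //; [|by computability..].
  by rewrite /program; repeat first [computable_step|exact: cE''].
by repeat first [exact: cC|computable_step|exact: cE|exact: cS].
Qed.

(** * Measure *)

Lemma prefix_code_ext X Y s : (forall i, i < s -> X i = Y i) -> prefix_code X s = prefix_code Y s.
Proof.
elim: s => //= s IH XY; rewrite XY// IH// => i lt_i.
by rewrite XY// ltnW.
Qed.

Lemma prefix_code_nbit w s : prefix_code (nbit w) s = w %% 2 ^ s.
Proof.
elim: s => [|s IH]; first by rewrite expn0 modn1.
rewrite /= IH /nbit; set q := w %/ 2 ^ s; set r := w %% 2 ^ s.
have r_lt : r < 2 ^ s by rewrite ltn_mod expn_gt0.
have -> : w = q./2 * 2 ^ s.+1 + (r + odd q * 2 ^ s).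
  rewrite [LHS](divn_eq w (2 ^ s)) -/q -/r -{1}[q]odd_double_half expnS -muln2; lia.
by rewrite modnMDl modn_small// expnS; case: (odd q); lia.
Qed.

Lemma prefix_code_cylinder w s : w < 2 ^ s ->
  [set X : coin_space | prefix_code X s = w] = cylinder (mkseq (nbit w) s).
Proof.
move=> w_lt; apply/seteqP; split=> X /=; rewrite /cylinder /= size_mkseq.
  by move=> <- i i_lt; rewrite nth_mkseq// nbit_prefix_code.
move=> H; rewrite -[RHS](modn_small w_lt) -prefix_code_nbit.
by apply: prefix_code_ext => i i_lt; rewrite H// nth_mkseq.
Qed.

(** Measurability below is reduced to this; [P] may be any predicate, computable or not, since only
    countably many cylinders are united. *)
Lemma measurable_prefix_code (P : set nat) s :
  measurable [set X : coin_space | P (prefix_code X s)].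
Proof.
rewrite (_ : mkset _ = \bigcup_(w in P) [set X | prefix_code X s = w]); last first.
  by apply/seteqP; split=> [X PX|X [w Pw /= ->]//]; exists (prefix_code X s).
apply: bigcup_measurable => w _; have [w_lt|w_ge] := ltnP w (2 ^ s).
  by rewrite prefix_code_cylinder//; exact: measurable_cylinder.
rewrite (_ : mkset _ = set0)//; apply/seteqP; split=> X //= E.
by have := ltn_prefix_code X s; rewrite E ltnNge w_ge.
Qed.

(** Convergence is expressed through stages, each depending on finitely many bits of [A], to make it
    measurable in [A]. *)
Definition halts e (A : nat -> bool) n y := exists s, bounded_run e (prefix_code A s) n s = y.+1.

Lemma halts_unique e A n s y y' :
  bounded_run e (prefix_code A s) n s = y.+1 -> halts e A n y' -> y = y'.
Proof.
move=> Hy [s' Hy'].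
have := bounded_run_mono (leq_maxl s s') Hy.
by rewrite (bounded_run_mono (leq_maxr s s') Hy') => -[].
Qed.

Lemma measurable_halts e n y : measurable [set A : coin_space | halts e A n y].
Proof.
rewrite (_ : mkset _ = \bigcup_s [set A | bounded_run e (prefix_code A s) n s = y.+1]); last first.
  by apply/seteqP; split=> [A [s Hs]|A [s _ /= Hs]]; exists s.
apply: bigcupT_measurable => s.
exact: (measurable_prefix_code [set w | bounded_run e w n s = y.+1] s).
Qed.

Lemma measurable_bad T E : measurable [set X : coin_space | bad T E X].
Proof.
exact: (measurable_prefix_code [set w | exists n, [/\ E <= n,
  attacks T E n && (nsnd (stage T E n) == w) & forall s, ~~ T E n s]] E.+2).
Qed.

Lemma measurable_ready T t n : measurable [set X : coin_space | ready T X t n].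
Proof.
rewrite (_ : mkset _ = \bigcap_E [set X | E < n.+1 -> active T X E n ->
    has (fun s => T E n s) (iota 0 t.+1)]); last first.
  apply/seteqP; split=> [X /allP H E _ E_lt|X H].
    by apply/implyP; apply: H; rewrite mem_iota add0n.
  by apply/allP => E; rewrite mem_iota add0n => E_lt; apply/implyP; exact: H.
apply: bigcapT_measurable => E.
exact: (measurable_prefix_code [set w | E < n.+1 ->
  attacks T E n && (nsnd (stage T E n) == w) -> has (fun s => T E n s) (iota 0 t.+1)] E.+2).
Qed.

Section measure.
Variable R : realType.
Local Open Scope ring_scope.
Local Notation mu := (fair_coin R).

Lemma fair_coin_prefix_code s w :
  (mu [set X : coin_space | prefix_code X s = w] <= ((2^-1) ^+ s)%:E)%E.
Proof.
have [w_lt|w_ge] := ltnP w (2 ^ s).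
  by rewrite prefix_code_cylinder// fair_coin_cylinder size_mkseq.
rewrite (_ : mkset _ = set0) ?measure0 ?lee_fin ?exprn_ge0//; apply/seteqP; split=> X //= E.
by have := ltn_prefix_code X s; rewrite E ltnNge w_ge.
Qed.

(** Connects the count in [often_total] with measure: the codes below [2 ^ s] name disjoint
    cylinders of equal measure, added one at a time. *)
Lemma fair_coin_count (b : pred nat) s :
  mu [set X : coin_space | b (prefix_code X s)] =
  ((count b (iota 0 (2 ^ s)))%:R * (2^-1) ^+ s)%:E.
Proof.
have H N : (N <= 2 ^ s)%N ->
    mu [set X : coin_space | (prefix_code X s < N)%N && b (prefix_code X s)] =
    ((count b (iota 0 N))%:R * (2^-1) ^+ s)%:E.
  elim: N => [|N IH] N_le.
    rewrite (_ : mkset _ = set0) ?measure0 ?mul0r//.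
    by apply/seteqP; split => X.
  have -> : count b (iota 0 N.+1) = (count b (iota 0 N) + b N)%N.
    by rewrite -[N.+1]addn1 iotaD count_cat /= add0n addn0.
  rewrite natrD mulrDl EFinD -(IH (ltnW N_le)).
  pose C := [set X : coin_space | (prefix_code X s = N) /\ b N].
  have -> : [set X : coin_space | (prefix_code X s < N.+1)%N && b (prefix_code X s)] =
      [set X : coin_space | (prefix_code X s < N)%N && b (prefix_code X s)] `|` C.
    apply/seteqP; split=> X /=; rewrite (ltnS (prefix_code X s)) (leq_eqVlt (prefix_code X s)).
      by move=> /andP[/orP[/eqP E|lt_N] bX]; [right; rewrite /C /= -E|left; rewrite lt_N].
    by move=> [/andP[-> ->]|[-> ->]]; rewrite ?orbT ?eqxx.
  rewrite measureU; first congr (_ + _)%E.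
  - have [bN|bN] := boolP (b N); last first.
      by rewrite (_ : C = set0) ?measure0 ?mul0r//; apply/seteqP; split=> X // [_ /idPn].
    rewrite mul1r (_ : C = cylinder (mkseq (nbit N) s)).
      by have := fair_coin_cylinder R (mkseq (nbit N) s); rewrite size_mkseq.
    by rewrite -prefix_code_cylinder//; apply/seteqP; split=> X //= -[].
  - exact: (measurable_prefix_code [set w | (w < N)%N && b w] s).
  - exact: (measurable_prefix_code [set w | w = N /\ b N] s).
  - by apply/seteqP; split=> X //= [/andP[lt_N _] [E _]]; rewrite E ltnn in lt_N.
rewrite -H//; congr (mu _); apply/seteqP; split=> X /=; rewrite ltn_prefix_code//.
Qed.

Lemma fair_coin_bigcup_bad T : (mu (\bigcup_E [set X : coin_space | bad T E X]) <= (2^-1)%:E)%E.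
Proof.
apply: (@le_trans _ _ (\sum_(0 <= E <oo) mu [set X : coin_space | bad T E X])%E).
  apply: measure_sigma_subadditive => // [E|]; first exact: measurable_bad.
  by apply: bigcupT_measurable => E; exact: measurable_bad.
have half0 : 0 <= 2^-1 :> R by rewrite invr_ge0.
(* Half of [2 ^ - E.+1] is the measure [2 ^ - E.+2] of the cylinder lost to [E], and these sum to
   [1/2]. *)
apply: le_trans (epsilon_trick0 xpredT half0).
apply: lee_nneseries => // E _.
have [w Hw] := bad_sub T E.
apply: (@le_trans _ _ (mu [set X : coin_space | prefix_code X E.+2 = w])).
  apply: le_measure; rewrite ?inE; [exact: measurable_bad| |exact: Hw].
  exact: (measurable_prefix_code [set w] E.+2).
apply: le_trans (fair_coin_prefix_code _ _) _.
by rewrite lee_fin natrX exprS -exprVn.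
Qed.

(** * Oracles that make a program total, and those that dominate *)

Definition total_below e n : set coin_space :=
  [set A | forall k, (k <= n)%N -> exists y, halts e A k y].

Definition total_prefix e n s : set coin_space :=
  [set A | total_upto e (prefix_code A s) n s].

Definition dominators e m (g : nat -> nat) : set coin_space :=
  [set A | forall n, exists2 y, halts e A n y & ((m < n)%N -> (g n < y)%N)].

Lemma measurable_total_prefix e n s : measurable (total_prefix e n s).
Proof. exact: (measurable_prefix_code [set w | total_upto e w n s] s). Qed.

Lemma total_prefix_mono e n s s' : (s <= s')%N -> total_prefix e n s `<=` total_prefix e n s'.
Proof.
move=> le_ss' A /allP H; apply/allP => k /H.
case E : bounded_run => [//|y] _.
by rewrite (bounded_run_mono le_ss' E).
Qed.

Lemma total_belowE e n : total_below e n = \bigcup_s total_prefix e n s.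
Proof.
apply/seteqP; split=> [A|A [s _ /allP H] k le_kn]; last first.
  have := H k; rewrite mem_iota add0n ltnS => /(_ le_kn).
  by case E : bounded_run => [//|y] _; exists y, s.
elim: n => [H|n IH H].
  have [y [s Hs]] := H 0%N (leqnn _); exists s => //.
  by apply/allP => k; rewrite mem_iota add0n ltnS leqn0 => /eqP ->; rewrite Hs.
have [s1 _ H1] : (\bigcup_s total_prefix e n s) A.
  by apply: IH => k le_kn; apply: H; rewrite (leq_trans le_kn).
have [y [s2 H2]] := H n.+1 (leqnn _); exists (maxn s1 s2) => //.
apply/allP => k; rewrite mem_iota add0n ltnS (leq_eqVlt k) => /orP[/eqP ->|lt_kn].
  by rewrite (bounded_run_mono (leq_maxr s1 s2) H2).
have /allP/(_ k) := total_prefix_mono (leq_maxl s1 s2) H1.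
by apply; rewrite mem_iota add0n.
Qed.

Lemma measurable_total_below e n : measurable (total_below e n).
Proof.
rewrite total_belowE; apply: bigcupT_measurable => s.
exact: measurable_total_prefix.
Qed.

Lemma measurable_dominators e m g : measurable (dominators e m g).
Proof.
rewrite (_ : dominators e m g = \bigcap_n \bigcup_(y in [set y | (m < n)%N -> (g n < y)%N])
    [set A | halts e A n y]); last first.
  apply/seteqP; split=> [A H n _|A H n]; first by have [y] := H n; exists y.
  by have [y] := H n I; exists y.
apply: bigcapT_measurable => n; apply: bigcup_measurable => y _.
exact: measurable_halts.
Qed.

(* With [2 < beta * b.+1], a multiple of [1 / b.+1] lies strictly in between. *)
Lemma fraction_between (beta delta : R) : 0 < beta -> beta <= delta ->
  exists a b : nat, delta - beta < a%:R / b.+1%:R < delta.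
Proof.
move=> beta0 le_bd; pose b := Num.truncn (2 / beta).
have b0 : 0 < b.+1%:R :> R by rewrite ltr0n.
have Hb : 2 < beta * b.+1%:R.
  have y0 : 0 <= 2 / beta by rewrite divr_ge0// ltW.
  by rewrite mulrC -ltr_pdivrMr//; have /andP[] := truncn_itv y0.
have x0 : 0 <= delta * b.+1%:R by rewrite mulr_ge0 ?ltW// (lt_le_trans beta0).
have /andP[h1 h2] := truncn_itv x0; set t := Num.truncn _ in h1 h2.
have le_bdb : beta * b.+1%:R <= delta * b.+1%:R by rewrite ler_pM2r.
have t0 : (0 < t)%N.
  rewrite lt0n; apply/eqP => t0; rewrite t0 in h2; lra.
exists t.-1, b; rewrite ltr_pdivrMr// ltr_pdivlMr// mulrBl.
have Et : t%:R = t.-1%:R + 1 :> R by rewrite natr1 prednK.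
rewrite -[t.+1%:R]natr1 Et in h2; rewrite Et in h1; lra.
Qed.

(** The hypothesis is what [ready_witness] supplies. If the set were non-null, the oracles found by
    the search would include one of its members. *)
Lemma dominators_null e m g :
  (forall E, (forall n, (E <= n)%N -> exists s, often_total E n s) ->
    exists n s, [/\ (E <= n)%N, (s <= g n)%N & often_total E n s]) ->
  mu (dominators e m g) = 0%E.
Proof.
move=> Hg; apply/eqP/contraT => muB.
set B := dominators e m g in muB *.
have mB : measurable B by exact: measurable_dominators.
pose D := \bigcap_n total_below e n.
have mD : measurable D by apply: bigcapT_measurable => n; exact: measurable_total_below.
have BD : B `<=` D by move=> A HA n _ k _; have [y] := HA k; exists y.
have fin A : measurable A -> mu A \is a fin_num by move=> mA; exact: fin_num_measure.
pose beta := fine (mu B); pose delta := fine (mu D).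
have Ebeta : mu B = beta%:E by rewrite fineK ?fin.
have Edelta : mu D = delta%:E by rewrite fineK ?fin.
have beta0 : 0 < beta by rewrite -lte_fin -Ebeta lt_neqAle eq_sym muB /=.
have le_bd : beta <= delta.
  by rewrite -lee_fin -Ebeta -Edelta le_measure ?inE.
have [a [b /andP[q1 q2]]] := fraction_between beta0 le_bd.
set q := a%:R / b.+1%:R in q1 q2.
have often E n s : program E = e -> nsnd (nfst E) = a -> nfst (nsnd E) = b ->
    often_total E n s = (q%:E <= mu (total_prefix e n s))%E.
  move=> Ee Ea Eb; rewrite /total_prefix (fair_coin_count (fun w => total_upto e w n s)) lee_fin.
  rewrite /often_total Ee Ea Eb ler_pdivrMr ?ltr0n// mulrAC exprVn ler_pdivlMr ?exprn_gt0//.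
  by rewrite -natrX -!natrM ler_nat [(b.+1 * _)%N]mulnC.
have lim_below : mu (total_below e n) @[n --> \oo] --> delta%:E.
  rewrite -Edelta; apply: nonincreasing_cvg_mu => //.
  - by rewrite ltey_eq fin//; exact: measurable_total_below.
  - by move=> n; exact: measurable_total_below.
  - by move=> n n' le_nn'; apply/subsetPset => A HA k le_k; apply: HA; rewrite (leq_trans le_k).
(* From [n0] on, [total_below e n] has measure less than [q + beta]: no room for a set of measure
   [q] disjoint from [B]. *)
have below_lt : (delta%:E < (q + beta)%:E)%E by rewrite lte_fin; lra.
have [n0 _ Hn0] := lim_below _ (open_ereal_lt' below_lt).
(* The padding ensures that [E <= n] gives both [n0 <= n] and [m < n]. *)
pose E := npair (npair e a) (npair b (maxn n0 m.+1)).
have [Ee Ea Eb] : [/\ program E = e, nsnd (nfst E) = a & nfst (nsnd E) = b].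
  by rewrite /program /E !(nfst_npair, nsnd_npair).
have padE : (maxn n0 m.+1 <= E)%N by rewrite (leq_trans (leq_npairr b _)) ?leq_npairr.
(* The search succeeds at every [n], because [q] is below the measure of [D] and the prefix sets
   increase to [total_below e n]. *)
have [n _|n [s [leE les]]] := Hg E.
  have lim_prefix : mu (total_prefix e n s) @[s --> \oo] --> mu (total_below e n).
    rewrite total_belowE; apply: nondecreasing_cvg_mu => //.
    - by move=> s; exact: measurable_total_prefix.
    - by rewrite -total_belowE; exact: measurable_total_below.
    - by move=> s s' le_ss'; apply/subsetPset; exact: total_prefix_mono.
  have prefix_gt : (q%:E < mu (total_below e n))%E.
    apply: (@lt_le_trans _ _ (mu D)); first by rewrite Edelta lte_fin.
    apply: le_measure; rewrite ?inE//; first exact: measurable_total_below.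
    by move=> A; exact.
  have [s _ Hs] := lim_prefix _ (open_ereal_gt' prefix_gt).
  by exists s; rewrite often//; apply/ltW/Hs => /=.
rewrite often// => Hq.
have [A [HA BA]] : total_prefix e n s `&` B !=set0.
  apply/set0P/eqP => disj.
  have : (mu (total_prefix e n s `|` B) <= mu (total_below e n))%E.
    apply: le_measure; rewrite ?inE//.
      by apply: measurableU => //; exact: measurable_total_prefix.
      exact: measurable_total_below.
    move=> A [HA|/BD]; last exact.
    by rewrite total_belowE; exists s.
  rewrite measureU//; last exact: measurable_total_prefix.
  apply/negP; rewrite -ltNge; apply: lt_le_trans (Hn0 n _) _.
    by rewrite /= (leq_trans _ leE)// (leq_trans _ padE)// leq_maxl.
  rewrite EFinD; apply: leeD; first exact: Hq.
    by have := lexx (mu B); rewrite {1}Ebeta.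
(* At this common point the output at [n] is at most [s <= g n], yet domination puts it above
   [g n]. *)
move: HA => /allP/(_ n); rewrite mem_iota add0n ltnSn => /(_ isT).
case Er : bounded_run => [//|y'] _.
have [y /(halts_unique Er) <- gy] := BA n.
have lt_g : (g n < y')%N.
  by apply: gy; rewrite (leq_trans _ leE)// (leq_trans _ padE)// leq_maxr.
by have := bounded_run_leq Er; rewrite leqNgt (leq_ltn_trans les lt_g).
Qed.

(** * The escaping functional and Fubini's theorem *)

Definition escape_value (X : nat -> bool) n z :=
  ready often_total X z n /\ forall z', (z' < z)%N -> ~~ ready often_total X z' n.

Lemma escape_value_unique X n z z' : escape_value X n z -> escape_value X n z' -> z = z'.
Proof.
move=> [rz z_min] [rz' z'_min]; have [lt_z|lt_z|//] := ltngtP z z'.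
- by have := z'_min _ lt_z; rewrite rz.
- by have := z_min _ lt_z; rewrite rz'.
Qed.

Lemma measurable_escape_value n z : measurable [set X : coin_space | escape_value X n z].
Proof.
rewrite (_ : mkset _ = [set X | ready often_total X z n] `&`
    \bigcap_z' [set X | (z' < z)%N -> ~~ ready often_total X z' n]); last first.
  by apply/seteqP; split=> X [rz z_min]; split=> // z' *; exact: z_min.
apply: measurableI; first exact: measurable_ready.
apply: bigcapT_measurable => z'; have [lt_z|le_z] := ltnP z' z; last first.
  by rewrite (_ : mkset _ = setT)//; apply/seteqP; split.
rewrite (_ : mkset _ = ~` [set X | ready often_total X z' n]).
  by apply: measurableC; exact: measurable_ready.
by apply/seteqP; split=> X /= => [/(_ isT)/negP|/negP].
Qed.

Definition never_bad : set coin_space :=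
  [set X | forall E, ~ bad often_total E X].

Lemma never_badE : never_bad = ~` \bigcup_E [set X : coin_space | bad often_total E X].
Proof.
apply/seteqP; split=> X /= H; first by move=> [E _]; exact: H.
by move=> E bX; apply: H; exists E.
Qed.

Lemma measurable_never_bad : measurable never_bad.
Proof.
rewrite never_badE; apply: measurableC; apply: bigcupT_measurable => E.
exact: measurable_bad.
Qed.

(** If this set were null, the bad sets would cover measure [1], more than the bound [1/2]. *)
Lemma never_bad_nonnull : mu never_bad != 0%E.
Proof.
rewrite never_badE probability_setC; last first.
  by apply: bigcupT_measurable => E; exact: measurable_bad.
have := fair_coin_bigcup_bad often_total; set p := mu _ => p_le.
apply/eqP => E; have p1 : (1 <= p)%E.
  by rewrite -sube_le0 E.
by have := le_trans p1 p_le; rewrite lee_fin leNgt invf_lt1// ltr1n.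
Qed.

(** Fubini's theorem needs a jointly measurable set, so [halts] and [escape_value] stand in for
    Turing reducibility. *)
Definition dominated_pairs e m : set (coin_space * coin_space) :=
  [set p | never_bad p.2 /\ forall n, exists y z,
    [/\ halts e p.1 n y, escape_value p.2 n z & (m < n)%N -> (z < y)%N]].

Lemma measurable_dominated_pairs e m : measurable (dominated_pairs e m).
Proof.
rewrite (_ : dominated_pairs e m = snd @^-1` never_bad `&`
    \bigcap_n \bigcup_y \bigcup_(z in [set z | (m < n)%N -> (z < y)%N])
      (fst @^-1` [set A | halts e A n y] `&` snd @^-1` [set X | escape_value X n z])); last first.
  apply/seteqP; split=> -[A X] [/= gX H]; split=> //.
    move=> n _; have [y [z [Hy Hz lt_zy]]] := H n; by exists y => //; exists z.
  move=> n; have [y _ [z lt_zy [Hy Hz]]] := H n I; by exists y, z.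
have m1 (S : set coin_space) : measurable S ->
    measurable (fst @^-1` S : set (coin_space * coin_space)).
  by move=> mS; rewrite -[X in measurable X]setTI; exact: measurable_fst.
have m2 (S : set coin_space) : measurable S ->
    measurable (snd @^-1` S : set (coin_space * coin_space)).
  by move=> mS; rewrite -[X in measurable X]setTI; exact: measurable_snd.
apply: measurableI; first by apply: m2; exact: measurable_never_bad.
apply: bigcapT_measurable => n; apply: bigcupT_measurable => y.
apply: bigcup_measurable => z _; apply: measurableI.
  by apply: m1; exact: measurable_halts.
by apply: m2; exact: measurable_escape_value.
Qed.

(** For good [X] the section lies in [dominators e m g], with [g] the escaping function at [X]; for
    other [X] it is empty. *)
Lemma ysection_dominated_pairs e m X : mu (ysection (dominated_pairs e m) X) = 0%E.
Proof.
have [gX|ngX] := pselect (never_bad X); last first.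
  rewrite (_ : ysection _ _ = set0) ?measure0//.
  by apply/seteqP; split=> A //; rewrite /ysection /= inE => -[].
have [c Hc] := escaping_functional computable_often_total.
have [g Hg] := Hc X gX.
apply/eqP; rewrite -measure_le0 -(@dominators_null e m g); last first.
  have rg n : ready often_total X (g n) n by have [] := Hg n.
  by move=> E; exact: ready_witness rg.
apply: le_measure; rewrite ?inE.
- by apply: measurable_ysection; exact: measurable_dominated_pairs.
- exact: measurable_dominators.
- move=> A; rewrite /ysection /= inE => -[_ H] n.
  have [y [z [Hy Hz lt_zy]]] := H n; exists y => //.
  have gz : escape_value X n (g n) by have [] := Hg n.
  by rewrite (escape_value_unique gz Hz).
Qed.

(** The measures of the sections have the same integral in both directions. One integrand vanishes,
    so the other, being non-negative, vanishes almost everywhere. *)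
Lemma xsection_dominated_pairs e m :
  \forall A \ae mu, mu (xsection (dominated_pairs e m) A) = 0%E.
Proof.
have mP := measurable_dominated_pairs e m.
have := indic_fubini_tonelli mu mu mP.
rewrite (indic_fubini_tonelli_FE mu mP).
rewrite (indic_fubini_tonelli_GE mu mP).
rewrite [RHS]integral0_eq; last by move=> X _; exact: ysection_dominated_pairs.
move=> int0; have mf := measurable_fun_xsection mu mP.
have /(ae_eq_integral_abs mu measurableT mf) :
    (\int[mu]_A `|(mu \o xsection (dominated_pairs e m)) A| = 0)%E.
  by rewrite -[RHS]int0; apply: eq_integral => A _; rewrite gee0_abs.
by apply: filterS => A /(_ I).
Qed.

End measure.

Theorem corollary3p10 (R : realType) :
  \forall A \ae fair_coin R, ~ ae_dominating R A.
Proof.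
(* There are countably many pairs [e, m], so one null set of [A] serves them all. *)
have ae_null : \forall A \ae fair_coin R, forall e m,
    fair_coin R (xsection (dominated_pairs e m) A) = 0%E.
  by apply: ae_foralln => e; apply: ae_foralln => m; exact: xsection_dominated_pairs.
apply: filterS ae_null => A null_section dom_A.
(* The contradiction: were [A] almost everywhere dominating, the non-null set [never_bad] would be
   null. *)
have /eqP[] := never_bad_nonnull R; apply/negligibleP; first exact: measurable_never_bad.
have ae_out : \forall X \ae fair_coin R, forall e m, ~ xsection (dominated_pairs e m) A X.
  apply: ae_foralln => e; apply: ae_foralln => m.
  apply: negligibleS (_ : (fair_coin R).-negligible (xsection (dominated_pairs e m) A)).
    by move=> X /= /contrapT.
  apply/negligibleP; last exact: null_section.
  by apply: measurable_xsection; exact: measurable_dominated_pairs.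
have : \forall X \ae fair_coin R, ~ never_bad X.
  have ae_F := ae_filter_ringOfSetsType (fair_coin R).
  apply: filterS2 dom_A ae_out => X dom_X out_X gX.
  have [c Hc] := escaping_functional computable_often_total.
  have [g Hg] := Hc X gX.
  have [f [[d Hd] [m Hm]]] : exists f, turing_reducible f A /\ dominates f g.
    by apply: dom_X; exists c => n; case: (Hg n).
  have [e He] := bounded_run_complete d.
  (* The program [e] for [f] and the threshold [m] put [X] into one of the null sections it was
     chosen to avoid. *)
  apply: (out_X e m); rewrite /xsection /= inE; split=> // n.
  by exists (f n), (g n); split; [exact: He|case: (Hg n)|exact: Hm].
by apply: negligibleS => X gX /=; apply.
Qed.
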